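(* Let $\mathcal{C}$ be a linear $(n,k,d,r,\delta)$-LRC over the finite field $\mathbb{F}_q$ (an $[n,k,d]$ linear code with all-symbol locality $(r,\delta)$), and let $\kappa_A=\log_q B_{l\text{-}c}(r+\delta-1,\delta)$ be the bound on the local dimension given by the best log-convex bound $B_{l\text{-}c}$, taken to be a positive integer. Let $\kappa_B$ be a positive integer with $\kappa_B\le\kappa_A$ which is an upper bound on the dimension of linear codes over $\mathbb{F}_q$ of length $r+\delta-1$ and minimum distance at least $\delta$ (the choice $\kappa_B=\kappa_A$ is allowed). Assume that $\mathcal{G}(\kappa_A,\delta)<r+\delta-1$ and let $$\delta_t := \frac{1}{1+\frac{1}{q-1}\left(\dfrac{1}{1-\frac{\mathcal{G}(\kappa_A,\delta)}{r+\delta-1}}\right)}.$$ Then for all relative minimum distances $\delta_n\in(\delta_t,1]$ the asymptotic rate bound with leading term $\frac{\kappa_B}{\mathcal{G}(\kappa_B,\delta)}\bigl(1-\frac{\delta_n}{1-1/q}\bigr)$ is stronger than the asymptotic rate bound with leading term $\frac{\kappa_A}{r+\delta-1}(1-\delta_n)$, i.e. $$\frac{\kappa_B}{\mathcal{G}(\kappa_B,\delta)}\left(1-\frac{\delta_n}{1-1/q}\right) < \frac{\kappa_A}{r+\delta-1}\,(1-\delta_n).$$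
   Context: $[n]=\{1,\dots,n\}$; $r,\delta$ are positive integers. An $[n,k,d]$ linear code over $\mathbb{F}_q$ has length $n$, dimension $k\ge1$ and minimum distance $d$; $\mathcal{C}|_I$ denotes restriction to the coordinates in $I$. The code has all-symbol locality $(r,\delta)$ if for every $i\in[n]$ there is $R\subseteq[n]$ with $i\in R$, $|R|\le r+\delta-1$, and the minimum distance of $\mathcal{C}|_R$ at least $\delta$. Griesmer function over $\mathbb{F}_q$: $\mathcal{G}(k,d)=\sum_{i=0}^{k-1}\lceil d/q^i\rceil$. $B_{l\text{-}c}(m,\delta)$ denotes an upper bound on the cardinality of codes over $\mathbb{F}_q$ of length $m$ and minimum distance $\delta$ that is log-convex in $m$, with $B_{l\text{-}c}(0,\delta)=1$; a positive function $f$ of an integer argument is log-convex if $f(j_1)f(j_2)\le f(j_1-1)f(j_2+1)$ for all $j_1\le j_2$ in its support. The two bounds being compared are, for the rate $\mathcal{R}=k/n$ and relative minimum distance $\delta_n=d/n$ of LRCs with fixed locality $(r,\delta)$ as $n\to\infty$: $\mathcal{R}\le\frac{\kappa_B}{\mathcal{G}(\kappa_B,\delta)}\bigl(1-\frac{\delta_n}{1-1/q}\bigr)+o(1)$ and $\mathcal{R}\le\frac{\kappa_A}{r+\delta-1}(1-\delta_n)+o(1)$. ''Stronger'' refers to comparing right-hand sides without the $o(1)$ terms. *)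

(* Defs.v *)
From mathcomp Require Import all_boot all_order all_algebra.
From mathcomp Require Import reals exp.

Set Implicit Arguments.
Unset Strict Implicit.
Unset Printing Implicit Defensive.

Import Order.TTheory GRing.Theory Num.Theory.
Local Open Scope ring_scope.

(* The alphabet is a finite field F, and q = #|F|; coordinates are indexed by
   'I_n, i.e. from 0. *)

Section Codes.
Variable F : finFieldType.

Definition hamming_dist (m : nat) (x y : 'rV[F]_m) : nat :=
  #|[set i | x 0 i != y 0 i]|.

(* Codes with at most one word have every minimum distance. *)
Definition min_dist_ge (m : nat) (C : {set 'rV[F]_m}) (d : nat) : Prop :=
  {in C &, forall x y, x != y -> (d <= hamming_dist x y)%N}.

Definition min_dist_eq (m : nat) (C : {set 'rV[F]_m}) (d : nat) : Prop :=
  min_dist_ge C d /\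
  exists x y, [/\ x \in C, y \in C, x != y & hamming_dist x y = d].

Definition codewords (m : nat) (C : {vspace 'rV[F]_m}) : {set 'rV[F]_m} :=
  [set x | x \in C].

(* The j-th coordinate of a restricted word is the coordinate at the j-th
   element of I. *)
Definition restrict (m : nat) (C : {set 'rV[F]_m}) (I : {set 'I_m}) :
    {set 'rV[F]_#|I|} :=
  [set colsub (@enum_val _ (mem I)) x | x in C].

Definition linear_code (n k d : nat) (C : {vspace 'rV[F]_n}) : Prop :=
  [/\ (0 < k)%N, \dim C = k & min_dist_eq (codewords C) d].

Definition all_symbol_locality (n r delta : nat) (C : {vspace 'rV[F]_n}) :
    Prop :=
  forall i : 'I_n, exists I : {set 'I_n},
    [/\ i \in I, (#|I| <= r + delta - 1)%N
      & min_dist_ge (restrict (codewords C) I) delta].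

Definition linear_LRC (n k d r delta : nat) (C : {vspace 'rV[F]_n}) : Prop :=
  linear_code k d C /\ all_symbol_locality r delta C.

Definition linear_dim_bound (m delta kappa : nat) : Prop :=
  forall C : {vspace 'rV[F]_m},
    min_dist_ge (codewords C) delta -> (\dim C <= kappa)%N.

End Codes.

(* The hypothesis 0 < j1 keeps j1 - 1 in the domain nat of f. *)
Definition log_convex (R : realType) (f : nat -> R) : Prop :=
  (forall j, 0 < f j) /\
  forall j1 j2, (0 < j1)%N -> (j1 <= j2)%N ->
    f j1 * f j2 <= f j1.-1 * f j2.+1.

(* The codes C here need not be linear. *)
Definition log_convex_bound (R : realType) (F : finFieldType)
    (B : nat -> nat -> R) (delta : nat) : Prop :=
  [/\ forall (m : nat) (C : {set 'rV[F]_m}),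
        min_dist_ge C delta -> #|C|%:R <= B m delta,
      log_convex (fun m => B m delta)
    & B 0%N delta = 1].

Definition griesmer (q k d : nat) : int :=
  \sum_(i < k) Num.ceil (d%:R / q%:R ^+ i : rat).

Definition logb (R : realType) (b x : R) : R := ln x / ln b.

(* N is the local length r + delta - 1 and G the value of the Griesmer
   function at (kappa_A, delta). *)
Definition rate_threshold (R : realType) (q N : nat) (G : int) : R :=
  1 / (1 + 1 / (q%:R - 1) * (1 / (1 - G%:~R / N%:R))).

(* Main.v *)
(* Rearranging, the claim for kappaB = kappaA is exactly the inequality
   delta_n > delta_t.  The terms of the Griesmer sum are nonincreasing, so its
   averages G(k, d) / k are nonincreasing in k and kappaB / G(kappaB, delta) is
   at most kappaA / G(kappaA, delta).  This settles the case where
   1 - delta_n / (1 - 1/q) is nonnegative; otherwise the left-hand side is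
   negative while the right-hand side is not. *)

Require Import Defs.
From mathcomp Require Import all_boot all_order all_algebra.
From mathcomp Require Import reals exp.
From mathcomp Require Import ring lra.

Import Order.TTheory GRing.Theory Num.Theory.
Local Open Scope ring_scope.

(** Induction on [a] upwards from [b]: the new term [c a] is at most each of the first [b] terms, so
    [b] copies of it are bounded by their sum. *)
Lemma nonincreasing_sum_average (R : numDomainType) (c : nat -> R)
    (hc : forall i j, (i <= j)%N -> c j <= c i) (a b : nat) (hab : (b <= a)%N) :
  b%:R * \sum_(i < a) c i <= a%:R * \sum_(i < b) c i.
Proof.
elim: a hab => [|a IHa]; first by rewrite leqn0 => /eqP->.
rewrite leq_eqVlt => /predU1P[-> //|]; rewrite ltnS => hba.
rewrite big_ord_recr /= mulrDr -natr1 mulrDl mul1r lerD ?IHa //.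
rewrite mulr_natl -[in leLHS](card_ord b) -sumr_const; apply: ler_sum => i _.
by apply: hc; apply: leq_trans (ltnW (ltn_ord i)) hba.
Qed.

Lemma griesmer_average (q d a b : nat) (hq : (0 < q)%N) (hab : (b <= a)%N) :
  b%:R * griesmer q a d <= a%:R * griesmer q b d.
Proof.
apply: (nonincreasing_sum_average _
  (fun i => Num.ceil (d%:R / q%:R ^+ i : rat))) => // i j hij.
apply: le_ceil; apply: ler_wpM2l => //.
rewrite lef_pV2 ?posrE ?exprn_gt0 ?ltr0n //.
by apply: ler_weXn2l => //; rewrite ler1n.
Qed.

Lemma griesmer_gt0 (q k d : nat) (hq : (0 < q)%N) (hk : (0 < k)%N)
    (hd : (0 < d)%N) :
  0 < griesmer q k d.
Proof.
have term_gt0 i : 0 < Num.ceil (d%:R / q%:R ^+ i : rat).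
  by rewrite ceil_gt0 divr_gt0 ?exprn_gt0 ?ltr0n.
case: k hk => // k _; rewrite /griesmer big_ord_recl ltr_wpDr //.
by apply: sumr_ge0 => i _; apply: ltW.
Qed.

(** This is the case [kappaB = kappaA] with the common positive factor [kappaA] cancelled; the
    inequality is affine in [x], with the threshold as its root. *)
Lemma rate_threshold_gain (R : realType) (q N : nat) (G : int) (x : R)
    (hq : (1 < q)%N) (hG0 : 0 < G) (hGN : G < N%:Z)
    (hx : rate_threshold R q N G < x) :
  (1 - x / (1 - 1 / q%:R)) / G%:~R < (1 - x) / N%:R.
Proof.
have g0 : (0 : R) < G%:~R by rewrite ltr0z.
have gN : (G%:~R : R) < N%:R by rewrite -[N%:R]/(N%:Z%:~R) ltr_int.
have q1 : (1 : R) < q%:R by rewrite ltr1n.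
move: hx; rewrite /rate_threshold.
move: (G%:~R : R) (N%:R : R) (q%:R : R) g0 gN q1 => g m p g0 gm p1.
have m0 : 0 < m by apply: lt_trans gm.
have thresholdE : 1 / (1 + 1 / (p - 1) * (1 / (1 - g / m)))
    = (m - g) * (p - 1) / (m * p - g * (p - 1)).
  field; rewrite ?gt_eqF //; nra.
(* The denominator equals [(m - g) * (p - 1) + m], a sum of positive terms. *)
have den0 : 0 < m * p - g * (p - 1) by nra.
rewrite thresholdE ltr_pdivrMr // => hx.
have -> : 1 - x / (1 - 1 / p) = (p - 1 - x * p) / (p - 1).
  by field; rewrite ?gt_eqF //; nra.
rewrite -mulrA -invfM ltr_pdivrMr ?mulr_gt0 ?subr_gt0 //.
(* With denominators cleared, the goal [(p - 1 - x * p) * m < (1 - x) * ((p - 1) * g)] is [hx] with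
   its terms regrouped. *)
rewrite mulrAC ltr_pdivlMr //; nra.
Qed.

Theorem proposition3 (R : realType) (F : finFieldType)
    (n k d r delta : nat) (hr : (0 < r)%N) (hdelta : (0 < delta)%N)
    (C : {vspace 'rV[F]_n}) (hC : linear_LRC k d r delta C)
    (B : nat -> nat -> R) (hB : log_convex_bound F B delta)
    (kappaA : nat) (hA0 : (0 < kappaA)%N)
    (hA : kappaA%:R = logb #|F|%:R (B (r + delta - 1)%N delta))
    (kappaB : nat) (hB0 : (0 < kappaB)%N) (hBA : (kappaB <= kappaA)%N)
    (hBdim : linear_dim_bound F (r + delta - 1) delta kappaB)
    (hG : griesmer #|F| kappaA delta < (r + delta - 1)%N%:Z)
    (delta_n : R)
    (ht : rate_threshold R #|F| (r + delta - 1) (griesmer #|F| kappaA delta)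
          < delta_n)
    (h1 : delta_n <= 1) :
  kappaB%:R / (griesmer #|F| kappaB delta)%:~R
      * (1 - delta_n / (1 - 1 / #|F|%:R))
    < kappaA%:R / (r + delta - 1)%N%:R * (1 - delta_n).
Proof.
set q := #|F| in hG ht *; set N := (r + delta - 1)%N in hG ht *.
have q1 : (1 < q)%N by apply: card_finNzRing_gt1.
have q0 : (0 < q)%N by apply: ltnW.
have GA0 := griesmer_gt0 q kappaA delta q0 hA0 hdelta.
have GB0 := griesmer_gt0 q kappaB delta q0 hB0 hdelta.
have gain : kappaA%:R / (griesmer q kappaA delta)%:~R
      * (1 - delta_n / (1 - 1 / q%:R))
    < kappaA%:R / N%:R * (1 - delta_n).
  rewrite -!mulrA ltr_pM2l ?ltr0n // ![_^-1 * _]mulrC.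
  exact: rate_threshold_gain ht.
have [y_ge0|y_lt0] := leP 0 (1 - delta_n / (1 - 1 / q%:R)).
  apply: le_lt_trans gain; apply: (ler_wpM2r y_ge0).
  (* Cross-multiplying by the positive Griesmer values leaves an integer inequality, the comparison
     of averages, read in [R]. *)
  rewrite ler_pdivrMr ?ltr0z // mulrAC ler_pdivlMr ?ltr0z //.
  have := griesmer_average q delta kappaA kappaB q0 hBA.
  by rewrite -(ler_int R) !intrM !natz.
(* Zero separates the two sides: the left one is strictly negative, and [h1] makes the right one
   nonnegative. *)
apply: (@lt_le_trans _ _ 0).
  by rewrite pmulr_rlt0 // divr_gt0 ?ltr0n ?ltr0z.
by rewrite mulr_ge0 ?divr_ge0 ?ler0n ?subr_ge0.
Qed.
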